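(* Suppose that $\mathbf h=(h_1,h_2,h_4)\in\mathbb Z^3\setminus\{\mathbf 0\}$ and $\varepsilon>0$. Then $T_3(P;\mathbf h)\ll P^{2+\varepsilon}$ for positive integers $P$, where the implied constant depends only on $\varepsilon$.
   Context: For a positive integer $P$ and an integer triple $\mathbf h=(h_1,h_2,h_4)\in\mathbb Z^3$ (indexed by $1,2,4$), $T_3(P;\mathbf h)$ denotes the number of integer tuples $(x_1,x_2,x_3,y_1,y_2,y_3)$ with $1\le x_i,y_i\le P$ $(1\le i\le 3)$ satisfying $$\sum_{i=1}^3(x_i^j-y_i^j)=h_j\quad (j=1,2,4).$$ *)

(* Defs.v *)
From mathcomp Require Import all_boot all_order all_algebra.

Set Implicit Arguments.
Unset Strict Implicit.
Unset Printing Implicit Defensive.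

Import Order.TTheory GRing.Theory Num.Theory.
Local Open Scope ring_scope.

Definition power_diff_sum (P j : nat) (x y : {ffun 'I_3 -> 'I_P.+1}) : int :=
  \sum_(i < 3) ((x i)%:Z ^+ j - (y i)%:Z ^+ j).

(* The variables range over 'I_P.+1 = {0, ..., P}; the positivity condition
   cuts this down to 1 <= x_i, y_i <= P. *)
Definition T3 (P : nat) (h1 h2 h4 : int) : nat :=
  #|[set xy : {ffun 'I_3 -> 'I_P.+1} * {ffun 'I_3 -> 'I_P.+1} |
      [&& [forall i, (0 < xy.1 i)%N && (0 < xy.2 i)%N],
          power_diff_sum 1 xy.1 xy.2 == h1,
          power_diff_sum 2 xy.1 xy.2 == h2
        & power_diff_sum 4 xy.1 xy.2 == h4]]|.

(* Main.v *)
Require Import Defs.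
From mathcomp Require Import all_boot all_order all_algebra.
From mathcomp Require Import reals exp zify ring lra.

Set Implicit Arguments.
Unset Strict Implicit.
Unset Printing Implicit Defensive.

Import Order.TTheory GRing.Theory Num.Theory.
Local Open Scope ring_scope.

(** Write the system as a + b + f = c + d + e + h1 and so on, and put
    s = a + b - c, t = d + e - f = s - h1, A = (a - c)(b - c),
    B = (d - f)(e - f).  The quadratic equation fixes K = 2(B - A) in terms
    of s, and the quartic one then reads 2 A E = N(s, f) with E a quadratic
    form in the unknowns.  If A E <> 0, then s, f and the two divisors a - c,
    b - c of N(s, f) determine the solution up to the order of d and e, so the
    divisor bound applies; B E <> 0 is symmetric.  If E = 0 and K <> 0, then s
    determines d + e + f and a + b + c.  If K = 0, either s is fixed (as
    h1 <> 0), or h1 = h2 = 0 and A E = h4 <> 0. *)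

(** * Algebraic identities for the system *)

Lemma sum_sqr_inj (d e d' e' : int) :
  d + e = d' + e' -> d ^+ 2 + e ^+ 2 = d' ^+ 2 + e' ^+ 2 ->
  (d <= e) = (d' <= e') -> d = d' /\ e = e'.
Proof.
move=> hs hq ho.
(* Eliminating [e] makes [d] a root of the quadratic with roots [d'] and [e']; the order condition
   then settles which one. *)
have : (d - d') * (d - e') == 0.
  have He : e = d' + e' - d by rewrite -hs; ring.
  have h2 : 2 * ((d - d') * (d - e')) = 0.
    move: hq; rewrite He => hq.
    have -> : 2 * ((d - d') * (d - e')) =
      d ^+ 2 + (d' + e' - d) ^+ 2 - (d' ^+ 2 + e' ^+ 2) by ring.
    by rewrite hq subrr.
  by move/eqP: h2; rewrite mulf_eq0.
rewrite mulf_eq0 !subr_eq0 => /orP[] /eqP h; lia.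
Qed.

Lemma sqr_inj_ge0 (x y : int) : 0 <= x -> 0 <= y -> x ^+ 2 = y ^+ 2 -> x = y.
Proof. by move=> x0 y0 /eqP; rewrite eqrXn2 // => /eqP. Qed.

(** Here [a, b, f] play the [x_i] and [c, d, e] the [y_i]. Exchanging [a, b, c] with [d, e, f] only
    changes the signs of the [h_j]. *)
Definition power_system (h1 h2 h4 a b c d e f : int) :=
  [/\ a + b + f - (c + d + e) = h1,
      a ^+ 2 + b ^+ 2 + f ^+ 2 - (c ^+ 2 + d ^+ 2 + e ^+ 2) = h2
    & a ^+ 4 + b ^+ 4 + f ^+ 4 - (c ^+ 4 + d ^+ 4 + e ^+ 4) = h4].

(* The factor E of 2 A E = N(s, f). *)
Definition cofact (a b c d e f : int) : int :=
  (d + e + f) ^+ 2 - (a + b + c) ^+ 2 - 3 * (a + b - c) ^+ 2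
  + 3 * (d + e - f) ^+ 2 - 4 * ((d - f) * (e - f) - (a - c) * (b - c)).

(* K = 2(B - A) as a function of s. *)
Definition shift2 (h1 h2 s : int) : int := h2 - s ^+ 2 + (s - h1) ^+ 2.

(* N(s, f); note that s - h1 + 2 * f = d + e + f. *)
Definition quartic (h1 h2 h4 s f : int) : int :=
  2 * h4 - 2 * s ^+ 4 + 2 * (s - h1) ^+ 4 + shift2 h1 h2 s ^+ 2
  - 3 * (s - h1) ^+ 2 * shift2 h1 h2 s
  - shift2 h1 h2 s * (s - h1 + 2 * f) ^+ 2.

Section PowerSystem.

Context (h1 h2 h4 a b c d e f : int).
Context (sol : power_system h1 h2 h4 a b c d e f).

Lemma power_system_sym : power_system (- h1) (- h2) (- h4) d e f a b c.
Proof. by case: sol => <- <- <-; split; ring. Qed.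

(** With [s = a + b - c] one has [a ^+ 2 + b ^+ 2 - c ^+ 2 = s ^+ 2 - 2 * A], and likewise for
    [d, e, f] with [B]. *)
Lemma shift2E :
  shift2 h1 h2 (a + b - c) = 2 * ((d - f) * (e - f) - (a - c) * (b - c)).
Proof. by case: sol => <- <- _; rewrite /shift2; ring. Qed.

(** The right side depends on [s] and [f] alone, so [a - c] and [b - c] divide a number known once
    these two are fixed. *)
Lemma quarticE :
  2 * ((a - c) * (b - c)) * cofact a b c d e f = quartic h1 h2 h4 (a + b - c) f.
Proof. by case: sol => <- <- <-; rewrite /quartic /shift2 /cofact; ring. Qed.

(** For fixed [s], this form leaves only the squares of [d + e + f] and [a + b + c] free. *)
Lemma cofactE : cofact a b c d e f =
  (a + b - c - h1 + 2 * f) ^+ 2 - (a + b + c) ^+ 2 - 3 * (a + b - c) ^+ 2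
  + 3 * (a + b - c - h1) ^+ 2 - 2 * shift2 h1 h2 (a + b - c).
Proof. by case: sol => <- <- _; rewrite /shift2 /cofact; ring. Qed.

Lemma sum_shiftE : a + b - c - h1 + 2 * f = d + e + f.
Proof. by case: sol => <- _ _; ring. Qed.

End PowerSystem.

Lemma cofact_sym a b c d e f : cofact d e f a b c = - cofact a b c d e f.
Proof. by rewrite /cofact; ring. Qed.

(** * Solutions sharing the value of s *)

Section TwoSolutions.

Context (h1 h2 h4 a b c d e f a' b' c' d' e' f' : int).
Context (sol : power_system h1 h2 h4 a b c d e f).
Context (sol' : power_system h1 h2 h4 a' b' c' d' e' f').

Lemma power_system_inj : a = a' -> b = b' -> c = c' -> f = f' ->
  (d <= e) = (d' <= e') -> d = d' /\ e = e'.
Proof.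
case: sol sol' => s1 s2 _ [s1' s2' _] ha hb hc hf.
apply: sum_sqr_inj; move: s1 s2 s1' s2'; rewrite ha hb hc hf; lra.
Qed.

Hypothesis eqs : a + b - c = a' + b' - c'.
Hypothesis cof0 : cofact a b c d e f = 0.
Hypothesis cof0' : cofact a' b' c' d' e' f' = 0.

(** When [E = 0], also [N(s, f) = 0], where [(d + e + f) ^+ 2] has the nonzero coefficient [- K]; so
    [s] fixes this square, and by sign [d + e + f] and [f]. Then [E = 0] fixes [a + b + c] in the
    same way. *)
Lemma cofact0_inj : 0 <= a + b + c -> 0 <= a' + b' + c' ->
  0 <= d + e + f -> 0 <= d' + e' + f' ->
  shift2 h1 h2 (a + b - c) != 0 -> a = a' -> [/\ b = b', c = c' & f = f'].
Proof.
move=> v0 v0' u0 u0' K0 eqa.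
have ef : f = f'.
  suff : a + b - c - h1 + 2 * f = a' + b' - c' - h1 + 2 * f' by lia.
  apply: sqr_inj_ge0; rewrite ?(sum_shiftE sol) ?(sum_shiftE sol') //.
  rewrite -(sum_shiftE sol) -(sum_shiftE sol').
  apply: (mulfI K0); move: (quarticE sol) (quarticE sol').
  rewrite cof0 cof0' !mulr0 -eqs /quartic.
  by move: (a + b - c) => s; move: (shift2 _ _ s) => k; lra.
have ev : a + b + c = a' + b' + c'.
  apply: sqr_inj_ge0 => //; move: (cofactE sol) (cofactE sol').
  rewrite cof0 cof0' -eqs -ef.
  by move: (a + b - c) => s; move: (shift2 _ _ s) => k; lra.
by split=> //; lia.
Qed.

(** Here [K] may vanish: [c] comes from [s], [a], [b], and [E = 0] alone then gives
    [(d + e + f) ^+ 2]. *)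
Lemma cofact0_inj_ab : 0 <= d + e + f -> 0 <= d' + e' + f' ->
  a = a' -> b = b' -> c = c' /\ f = f'.
Proof.
move=> u0 u0' eqa eqb; have eqc : c = c' by lia.
split=> //.
suff : a + b - c - h1 + 2 * f = a' + b' - c' - h1 + 2 * f' by lia.
apply: sqr_inj_ge0; rewrite ?(sum_shiftE sol) ?(sum_shiftE sol') //.
rewrite -(sum_shiftE sol) -(sum_shiftE sol').
move: (cofactE sol) (cofactE sol').
rewrite cof0 cof0' -eqs -eqa -eqb -eqc.
by move: (a + b - c) => s; move: (shift2 _ _ s) => k; lra.
Qed.

End TwoSolutions.

(** * Size of N(s, f) and families of solutions *)

Lemma quartic_bound (P a b c d e f : nat) :
  (a <= P)%N -> (b <= P)%N -> (c <= P)%N ->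
  (d <= P)%N -> (e <= P)%N -> (f <= P)%N ->
  (absz (2 * ((a%:Z - c%:Z) * (b%:Z - c%:Z)) * cofact a b c d e f)%R
    <= 100 * P ^ 4)%N.
Proof.
move=> ha hb hc hd he hf.
have hA (x y z : nat) : (x <= P)%N -> (y <= P)%N -> (z <= P)%N ->
    `|(x%:Z - z%:Z) * (y%:Z - z%:Z)| <= P%:Z ^+ 2.
  move=> hx hy hz; rewrite normrM expr2; apply: ler_pM => //; lia.
have hs (k x : int) : 0 <= k -> `|x| <= k * P%:Z -> 0 <= x ^+ 2 <= k ^+ 2 * P%:Z ^+ 2.
  move=> k0 hx; rewrite sqr_ge0 /= -exprMn -real_normK ?num_real //.
  by apply: lerXn2r => //; rewrite nnegrE // mulr_ge0.
have A1 := hA _ _ _ ha hb hc; have A2 := hA _ _ _ hd he hf.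
(* The terms give at most 9 + 12 + 8 = 29 times [P ^ 2]; the slack makes the final constant a round
   100. *)
have hE : `|cofact a b c d e f| <= 50 * P%:Z ^+ 2.
  have u1 := hs 3 (d%:Z + e%:Z + f%:Z) isT ltac:(lia).
  have u2 := hs 3 (a%:Z + b%:Z + c%:Z) isT ltac:(lia).
  have u3 := hs 2 (a%:Z + b%:Z - c%:Z) isT ltac:(lia).
  have u4 := hs 2 (d%:Z + e%:Z - f%:Z) isT ltac:(lia).
  rewrite /cofact; move: u1 u2 u3 u4 A1 A2.
  set x1 := (d%:Z + e%:Z + f%:Z) ^+ 2; set x2 := (a%:Z + b%:Z + c%:Z) ^+ 2.
  set x3 := (a%:Z + b%:Z - c%:Z) ^+ 2; set x4 := (d%:Z + e%:Z - f%:Z) ^+ 2.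
  set y1 := (a%:Z - c%:Z) * _; set y2 := (d%:Z - f%:Z) * _; set q := P%:Z ^+ 2.
  move: x1 x2 x3 x4 y1 y2 q; clear; lia.
rewrite -lez_nat abszE !normrM normr_nat.
have -> : (100 * P ^ 4)%N%:Z = (2 * P%:Z ^+ 2) * (50 * P%:Z ^+ 2).
  by rewrite !expnS expn0 !PoszM; ring.
rewrite -normrM; apply: ler_pM => //; lia.
Qed.

(** Abstract coordinate functions let each counting argument be reused after exchanging [a, b, c]
    with [d, e, f]. *)
Record solution_family (T : finType) (P : nat) (h1 h2 h4 : int) (S : {set T})
    (a b c d e f : T -> nat) : Prop := SolutionFamily {
  family_bound : forall x,
    [/\ (a x <= P)%N, (b x <= P)%N & (c x <= P)%N] /\
    [/\ (d x <= P)%N, (e x <= P)%N & (f x <= P)%N];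
  family_eq : forall x, x \in S ->
    power_system h1 h2 h4 (a x) (b x) (c x) (d x) (e x) (f x);
  family_inj : forall x y, a x = a y -> b x = b y -> c x = c y ->
    d x = d y -> e x = e y -> f x = f y -> x = y }.

Lemma solution_family_sym (T : finType) P h1 h2 h4 (S : {set T})
    (a b c d e f : T -> nat) :
  solution_family P h1 h2 h4 S a b c d e f ->
  solution_family P (- h1) (- h2) (- h4) S d e f a b c.
Proof.
case=> bd eqS inj; split=> [x|x xS|x y *].
- by have [? ?] := bd x.
- exact/power_system_sym/eqS.
- exact: inj.
Qed.

Lemma inord_inj n i j : (i <= n)%N -> (j <= n)%N ->
  inord i = inord j :> 'I_n.+1 -> i = j.
Proof. by move=> lin ljn /(congr1 val) /=; rewrite !inordK. Qed.

(** Codes a divisor by its position in the list of divisors, so that keys live in a fixed finite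
    type. *)
Lemma inord_index_inj n (l : seq nat) i j : (size l <= n)%N ->
  i \in l -> j \in l -> inord (index i l) = inord (index j l) :> 'I_n.+1 -> i = j.
Proof.
move=> ln il jl /inord_inj-/(_ (leq_trans (index_size _ _) ln)).
by move=> /(_ (leq_trans (index_size _ _) ln)); apply: index_inj.
Qed.

(** * Counting each case by an injective key *)

Section Families.

Context (T : finType) (P : nat) (h1 h2 h4 : int) (S : {set T}).
Context (a b c d e f : T -> nat).
Hypothesis fam : solution_family P h1 h2 h4 S a b c d e f.

Let s x : int := (a x)%:Z + (b x)%:Z - (c x)%:Z.
Let cof x : int :=
  cofact (a x)%:Z (b x)%:Z (c x)%:Z (d x)%:Z (e x)%:Z (f x)%:Z.

Lemma family_inj_abcf x y : x \in S -> y \in S ->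
  a x = a y -> b x = b y -> c x = c y -> f x = f y ->
  (d x <= e x)%N = (d y <= e y)%N -> x = y.
Proof.
move=> xS yS ha hb hc hf ho.
have [] := power_system_inj (family_eq fam xS) (family_eq fam yS).
1-5: lia.
by move=> [hd] [he]; apply: (family_inj fam).
Qed.

(** This is [s + P], a natural number: the truncated subtraction is exact because [c x <= P]. *)
Let skey x := (a x + b x + P - c x)%N.

Let skey_le x : (skey x <= 3 * P)%N.
Proof. by have [[? ? ?] _] := family_bound fam x; rewrite /skey; lia. Qed.

Let skeyP x y : skey x = skey y <-> s x = s y.
Proof.
have [[? ? ?] _] := family_bound fam x; have [[? ? ?] _] := family_bound fam y.
by rewrite /skey /s; split; lia.
Qed.

(** The key consists of [s], [f], the positions of [|a - c|] and [|b - c|] among the divisors of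
    [N(s, f)], and three order bits, whence the factor 8. *)
Lemma card_divisor_case (D : nat) :
    (forall n, (0 < n <= 100 * P ^ 4)%N -> (size (divisors n) <= D)%N) ->
  (#|[set x in S | [&& a x != c x, b x != c x & cof x != 0]]|
    <= 8 * ((3 * P).+1 * P.+1 * D.+1 ^ 2))%N.
Proof.
move=> hD.
pose N x := absz (quartic h1 h2 h4 (s x) (f x)).
pose ind (u v : T -> nat) x :=
  index (absz ((u x)%:Z - (v x)%:Z)) (divisors (N x)).
pose key x := (inord (skey x) : 'I_(3 * P).+1, inord (f x) : 'I_P.+1,
   inord (ind a c x) : 'I_D.+1, inord (ind b c x) : 'I_D.+1,
   ((a x <= c x)%N, (b x <= c x)%N, (d x <= e x)%N)).
apply: (@leq_trans #|{: 'I_(3 * P).+1 * 'I_P.+1 * 'I_D.+1 * 'I_D.+1 *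
    (bool * bool * bool)}|); last first.
  by rewrite !card_prod !card_ord !card_bool; lia.
apply: (@leq_card_in _ _ key) => x y; rewrite !inE.
have main z : z \in S -> a z != c z -> b z != c z -> cof z != 0 ->
  [/\ (size (divisors (N z)) <= D)%N,
      absz ((a z)%:Z - (c z)%:Z) \in divisors (N z)
    & absz ((b z)%:Z - (c z)%:Z) \in divisors (N z)].
  move=> zS ac bc cz; have NE := quarticE (family_eq fam zS).
  have [[? ? ?] [? ? ?]] := family_bound fam z.
  have N0 : (0 < N z)%N.
    rewrite /N -NE absz_gt0 mulf_neq0 // !mulf_neq0 //; lia.
  rewrite -!dvdn_divisors //; split.
  - by apply: hD; rewrite N0 /= /N -NE quartic_bound.
  - by rewrite /N -NE !abszM dvdn_mulr // dvdn_mull // dvdn_mulr.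
  - by rewrite /N -NE !abszM dvdn_mulr // dvdn_mull // dvdn_mull.
move=> /andP[xS /and3P[acx bcx cfx]] /andP[yS /and3P[acy bcy cfy]].
have [Dx ax bx] := main _ xS acx bcx cfx.
have [Dy ay by_] := main _ yS acy bcy cfy.
have [[? ? ?] [? ? ?]] := family_bound fam x.
have [[? ? ?] [? ? ?]] := family_bound fam y.
case=> /inord_inj-/(_ (skey_le _) (skey_le _)) hs.
move=> /inord_inj-/(_ ltac:(done) ltac:(done)) hf.
have eN : N x = N y by rewrite /N hf (proj1 (skeyP _ _) hs).
rewrite eN in ax bx; rewrite /ind eN.
move=> /(inord_index_inj Dy ax ay) hac /(inord_index_inj Dy bx by_) hbc sac sbc sde.
(* The order bits restore the signs of [a - c] and [b - c]; then [s = (a - c) + (b - c) + c] yields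
   [c]. *)
have [] : [/\ a x = a y, b x = b y & c x = c y].
  move: hs; rewrite /skey; split; lia.
by move=> ha hb hc; apply: family_inj_abcf.
Qed.

Lemma card_cofact0 :
  (#|[set x in S | (cof x == 0) && (shift2 h1 h2 (s x) != 0)]|
    <= 2 * ((3 * P).+1 * P.+1))%N.
Proof.
pose key x := (inord (skey x) : 'I_(3 * P).+1, inord (a x) : 'I_P.+1,
   (d x <= e x)%N).
apply: (@leq_trans #|{: 'I_(3 * P).+1 * 'I_P.+1 * bool}|); last first.
  by rewrite !card_prod !card_ord !card_bool; lia.
apply: (@leq_card_in _ _ key) => x y; rewrite !inE.
move=> /andP[xS /andP[/eqP cfx kx]] /andP[yS /andP[/eqP cfy ky]].
have [[? ? ?] [? ? ?]] := family_bound fam x.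
have [[? ? ?] [? ? ?]] := family_bound fam y.
case=> /inord_inj-/(_ (skey_le _) (skey_le _)) /skeyP hs.
move=> /inord_inj-/(_ ltac:(done) ltac:(done)) ha sde.
have [] := cofact0_inj (family_eq fam xS) (family_eq fam yS) hs cfx cfy
  isT isT isT isT kx (congr1 Posz ha).
by move=> [hb] [hc] [hf]; apply: family_inj_abcf.
Qed.

Hypothesis h1_neq0 : h1 != 0.

(** The squares of [s] cancel: [K = h2 + h1 ^+ 2 - 2 * h1 * s] is linear in [s] with nonzero
    slope. *)
Let shift2_inj x y : shift2 h1 h2 (s x) = 0 -> shift2 h1 h2 (s y) = 0 ->
  s x = s y.
Proof.
rewrite /shift2 => hx hy; apply: (mulfI h1_neq0); lra.
Qed.

(** Since [K = 0] fixes [s], the pair [a, b] takes over the role of [s, a] in the key. *)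
Lemma card_cofact0_shift2_0 :
  (#|[set x in S | (cof x == 0) && (shift2 h1 h2 (s x) == 0)]|
    <= 2 * (P.+1 * P.+1))%N.
Proof.
pose key x := (inord (a x) : 'I_P.+1, inord (b x) : 'I_P.+1, (d x <= e x)%N).
apply: (@leq_trans #|{: 'I_P.+1 * 'I_P.+1 * bool}|); last first.
  by rewrite !card_prod !card_ord !card_bool; lia.
apply: (@leq_card_in _ _ key) => x y; rewrite !inE.
move=> /andP[xS /andP[/eqP cfx /eqP kx]] /andP[yS /andP[/eqP cfy /eqP ky]].
have [[? ? ?] [? ? ?]] := family_bound fam x.
have [[? ? ?] [? ? ?]] := family_bound fam y.
have hs := shift2_inj kx ky.
case=> /inord_inj-/(_ ltac:(done) ltac:(done)) ha.
move=> /inord_inj-/(_ ltac:(done) ltac:(done)) hb sde.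
have [] := cofact0_inj_ab (family_eq fam xS) (family_eq fam yS) hs cfx cfy
  isT isT (congr1 Posz ha) (congr1 Posz hb).
by move=> [hc] [hf]; apply: family_inj_abcf.
Qed.

(** Again [s] is fixed. If [a = c] then [b = s], and if [b = c] then [a = s]; one bit of the key
    tells which holds. *)
Lemma card_diagonal :
  (#|[set x in S | [&& (a x == c x) || (b x == c x)
                   & shift2 h1 h2 (s x) == 0]]|
    <= 4 * (P.+1 * P.+1))%N.
Proof.
pose key x := (inord (c x) : 'I_P.+1, inord (f x) : 'I_P.+1,
  a x == c x, (d x <= e x)%N).
apply: (@leq_trans #|{: 'I_P.+1 * 'I_P.+1 * bool * bool}|); last first.
  by rewrite !card_prod !card_ord !card_bool; lia.
apply: (@leq_card_in _ _ key) => x y; rewrite !inE.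
move=> /andP[xS /andP[dx /eqP kx]] /andP[yS /andP[dy /eqP ky]].
have [[? ? ?] [? ? ?]] := family_bound fam x.
have [[? ? ?] [? ? ?]] := family_bound fam y.
have := shift2_inj kx ky; rewrite /s => hs.
case=> /inord_inj-/(_ ltac:(done) ltac:(done)) hc.
move=> /inord_inj-/(_ ltac:(done) ltac:(done)) hf sac sde.
by apply: family_inj_abcf => //; lia.
Qed.

End Families.

(** * Combination of the cases *)

Lemma card_solution_family (T : finType) (P : nat) (h1 h2 h4 : int) (S : {set T})
    (a b c d e f : T -> nat) (D : nat) :
  solution_family P h1 h2 h4 S a b c d e f ->
  (h1, h2, h4) <> (0, 0, 0) -> (0 < P)%N ->
  (forall n, (0 < n <= 100 * P ^ 4)%N -> (size (divisors n) <= D)%N) ->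
  (#|S| <= 168 * (P ^ 2 * D.+1 ^ 2))%N.
Proof.
move=> fam hn0 P_gt0 hD; have fam' := solution_family_sym fam.
have c1 := card_divisor_case fam hD; have c2 := card_divisor_case fam' hD.
have c3 := card_cofact0 fam.
set S1 := [set _ in S | _] in c1; set S2 := [set _ in S | _] in c2.
set S3 := [set _ in S | _] in c3.
(* With these bounds the five cases contribute 64 + 64 + 16 + 8 + 16 = 168. *)
have P1 : (P.+1 * P.+1 <= 4 * P ^ 2)%N by nia.
have P2 : ((3 * P).+1 * P.+1 <= 8 * P ^ 2)%N by nia.
have D1 : (P ^ 2 <= P ^ 2 * D.+1 ^ 2)%N by rewrite leq_pmulr // expn_gt0.
have P3 : ((3 * P).+1 * P.+1 * D.+1 ^ 2 <= 8 * (P ^ 2 * D.+1 ^ 2))%N.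
  by rewrite mulnA leq_mul.
(* If [K = 2 * (B - A)] is nonzero, [A] and [B] cannot both vanish, so [E <> 0] leads to [S1] or
   [S2], and [E = 0] to [S3]. *)
have inS x : x \in S ->
    shift2 h1 h2 ((a x)%:Z + (b x)%:Z - (c x)%:Z) != 0 ->
    x \in S1 :|: S2 :|: S3.
  move=> xS k0; rewrite !inE xS /= k0 andbT.
  have kE := shift2E (family_eq fam xS).
  rewrite cofact_sym oppr_eq0.
  have [_|_] := eqVneq (cofact _ _ _ _ _ _) 0; first by rewrite orbT.
  rewrite orbF !andbT; apply: contraNT k0.
  rewrite negb_or !negb_and !negbK kE.
  by case/andP=> /orP[] /eqP-> /orP[] /eqP->; apply/eqP; ring.
(* For [h1 = 0], [K] is the constant [h2]. If [h2 = 0] too, then [N = 2 * h4] is nonzero and every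
   solution lies in [S1]. *)
have [h10|h1_neq0] := eqVneq h1 0.
  have SS : S \subset S1 :|: S2 :|: S3.
    apply/subsetP => x xS; have := inS _ xS.
    rewrite /shift2 h10 subr0 subrK; have [h20 _|h2n] := eqVneq h2 0; last first.
      by move=> ->.
    have h40 : h4 != 0 by apply/eqP => h40; apply: hn0; rewrite h10 h20 h40.
    have := quarticE (family_eq fam xS).
    have -> s u : quartic h1 h2 h4 s u = 2 * h4.
      by rewrite /quartic /shift2 h10 h20; ring.
    move=> qE; have : 2 * h4 != 0 by rewrite mulf_neq0.
    rewrite -qE !mulf_eq0 !negb_or => /andP[/andP[_ /andP[ac bc]] cf].
    rewrite !inE xS cf !andbT /=.
    by rewrite !subr_eq0 !eqz_nat in ac bc; rewrite ac bc.
  have := subset_leq_card SS; have := cardsU (S1 :|: S2) S3.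
  have := cardsU S1 S2; lia.
have c4 := card_cofact0_shift2_0 fam h1_neq0.
have c5 := card_diagonal fam h1_neq0.
set S4 := [set _ in S | _] in c4; set S5 := [set _ in S | _] in c5.
(* When [K = 0], either [E = 0] ([S4]), or [A = 0] ([S5]), or [A * E <> 0] ([S1]). *)
have SS : S \subset S1 :|: S2 :|: S3 :|: S4 :|: S5.
  apply/subsetP => x xS; have := inS _ xS.
  case: eqP => [k0 _|_ /(_ isT)]; last by rewrite !inE => ->.
  rewrite !inE xS /= k0 eqxx /= !andbT.
  by case: (_ == 0); case: (a x == c x); case: (b x == c x); rewrite ?orbT.
have := subset_leq_card SS; have := cardsU (S1 :|: S2 :|: S3 :|: S4) S5.
have := cardsU (S1 :|: S2 :|: S3) S4; have := cardsU (S1 :|: S2) S3.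
have := cardsU S1 S2; lia.
Qed.

Lemma solution_family_T3 (P : nat) (h1 h2 h4 : int) :
  let i1 : 'I_3 := lift ord0 ord0 in
  let i2 : 'I_3 := lift ord0 (lift ord0 ord0) in
  solution_family P h1 h2 h4
    [set xy : {ffun 'I_3 -> 'I_P.+1} * {ffun 'I_3 -> 'I_P.+1} |
      [&& [forall i, (0 < xy.1 i)%N && (0 < xy.2 i)%N],
          power_diff_sum 1 xy.1 xy.2 == h1,
          power_diff_sum 2 xy.1 xy.2 == h2
        & power_diff_sum 4 xy.1 xy.2 == h4]]
    (fun xy => xy.1 ord0) (fun xy => xy.1 i1) (fun xy => xy.2 ord0)
    (fun xy => xy.2 i1) (fun xy => xy.2 i2) (fun xy => xy.1 i2).
Proof.
move=> i1 i2; split.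
- by move=> xy; split; split; rewrite -ltnS ltn_ord.
- move=> xy; rewrite inE => /and4P[_ /eqP<- /eqP<- /eqP<-].
  by rewrite /power_diff_sum; split; rewrite !big_ord_recl big_ord0 /=; ring.
move=> [x y] [x' y'] /= e1 e2 e3 e4 e5 e6.
have I3 (u v : {ffun 'I_3 -> 'I_P.+1}) :
    u ord0 = v ord0 :> nat -> u i1 = v i1 :> nat -> u i2 = v i2 :> nat -> u = v.
  move=> h0 h1' h2'; apply/ffunP => i; apply: val_inj.
  have : [|| i == ord0, i == i1 | i == i2] by case: i => [[|[|[|]]]].
  by case/or3P=> /eqP->.
by congr pair; apply: I3.
Qed.

(** * The divisor bound *)

Lemma size_divisors_part (p n : nat) : prime p -> (0 < n)%N ->
  (size (divisors n) <= (logn p n).+1 * size (divisors n`_p^'))%N.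
Proof.
move=> pr_p n_gt0.
(* A divisor is determined by its exponent at [p] and its part prime to [p]. *)
pose split_at d := (logn p d, d`_p^')%N.
rewrite -(size_map split_at) -(size_iota 0 (logn p n).+1) -(size_allpairs pair).
apply: uniq_leq_size.
  rewrite map_inj_in_uniq ?divisors_uniq // => d d'.
  rewrite -!dvdn_divisors // => /dvdn_gt0-/(_ n_gt0) d0 /dvdn_gt0-/(_ n_gt0) d0'.
  case=> el ep; rewrite -(partnC p d0) -(partnC p d0') ep.
  by rewrite !p_part el.
move=> _ /mapP[d + ->]; rewrite -dvdn_divisors // => dn.
apply/allpairsP; exists (split_at d); split => //.
  by rewrite mem_iota /= add0n ltnS dvdn_leq_log.
by rewrite -dvdn_divisors ?part_gt0 //= partn_dvd.
Qed.

(** With [m = e %/ k], [e + 1 <= k * (m + 1) <= k * 2 ^ m]; take [k]-th powers and use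
    [m * k <= e]. *)
Lemma succ_expn_le (k p e : nat) : (0 < k)%N -> (1 < p)%N ->
  (e.+1 ^ k <= k ^ k * p ^ e)%N.
Proof.
move=> k_gt0 p_gt1.
have e1 : (e.+1 <= k * 2 ^ (e %/ k))%N.
  apply: (@leq_trans (k * (e %/ k).+1)); first by rewrite mulnC ltn_ceil.
  by rewrite leq_pmul2l // ltn_expl.
apply: (@leq_trans ((k * 2 ^ (e %/ k)) ^ k)); first by rewrite leq_exp2r.
rewrite expnMn leq_mul2l -expnM; apply/orP; right.
apply: (@leq_trans (p ^ (e %/ k * k))); first by case: (e %/ k * k)%N => // m; rewrite leq_exp2r.
by rewrite leq_exp2l // leq_trunc_div.
Qed.

(** Since [e + 1 <= 2 ^ e], the left side is at most [(2 ^ k) ^ e]. *)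
Lemma succ_expn_le_large (k p e : nat) : (2 ^ k <= p)%N -> (e.+1 ^ k <= p ^ e)%N.
Proof.
move=> hp; apply: (@leq_trans ((2 ^ e) ^ k)).
  by case: k {hp} => // k; rewrite leq_exp2r // ltn_expl.
rewrite -expnM mulnC expnM.
by case: e => // e; rewrite leq_exp2r.
Qed.

(* Only the primes below 2 ^ k cost a constant factor k ^ k. *)
Lemma size_divisors_expn_count (k n : nat) : (0 < k)%N -> (0 < n)%N ->
  (size (divisors n) ^ k
    <= (k ^ k) ^ (count (fun p => p < 2 ^ k)%N (primes n)) * n)%N.
Proof.
move=> k_gt0; have [m] := ubnP n; elim: m n => // m IH n ltnm n_gt0.
have [n1|n_gt1] := leqP n 1.
  have -> : n = 1%N by lia.
  by rewrite exp1n muln1 expn_gt0 expn_gt0 k_gt0.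
(* Strong induction removes the full power of the least prime factor. *)
set p := pdiv n; have pr_p : prime p := pdiv_prime n_gt1.
have p_in : p \in primes n by rewrite mem_primes pr_p n_gt0 pdiv_dvd.
set q := (n`_p^')%N; have q_gt0 : (0 < q)%N by rewrite part_gt0.
have nE : (p ^ logn p n * q)%N = n by rewrite -p_part partnC.
have ltqn : (q < n)%N.
  rewrite -nE ltn_Pmull // -[1%N](expn0 p) ltn_exp2l ?prime_gt1 //.
  by rewrite logn_gt0.
have cE : count (fun p => p < 2 ^ k)%N%N (primes n) =
    ((p < 2 ^ k) + count (fun p => p < 2 ^ k)%N (primes q))%N.
  rewrite (permP (perm_to_rem p_in)) /= primes_part rem_filter ?primes_uniq //.
apply: (@leq_trans (((logn p n).+1 * size (divisors q)) ^ k)).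
  by rewrite leq_exp2r // size_divisors_part.
rewrite expnMn cE expnD -{2}nE -mulnA [X in (_ <= _ * X)%N]mulnCA mulnA.
apply: leq_mul; last by apply: IH => //; lia.
case: ltnP => hp; first by rewrite expn1 succ_expn_le ?prime_gt1.
by rewrite expn0 mul1n succ_expn_le_large.
Qed.

(** At most [2 ^ k] primes lie below [2 ^ k], so the constant becomes independent of [n]. *)
Lemma size_divisors_expn (k n : nat) : (0 < k)%N -> (0 < n)%N ->
  (size (divisors n) ^ k <= (k ^ k) ^ (2 ^ k) * n)%N.
Proof.
move=> k_gt0 n_gt0; apply: leq_trans (size_divisors_expn_count k_gt0 n_gt0) _.
rewrite leq_mul2r; apply/orP; right.
apply: leq_pexp2l; first by rewrite expn_gt0 k_gt0.
rewrite -size_filter -[X in (_ <= X)%N](size_iota 0).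
apply: uniq_leq_size; first by rewrite filter_uniq ?primes_uniq.
by move=> p; rewrite mem_filter mem_iota => /andP[].
Qed.

(** * From divisor counts to the exponent 2 + eps *)

Lemma T3_bound (P k : nat) (h1 h2 h4 : int) :
  (h1, h2, h4) <> (0, 0, 0) -> (0 < P)%N -> (0 < k)%N ->
  exists D : nat, (D ^ k <= (k ^ k) ^ (2 ^ k) * (100 * P ^ 4))%N /\
    (T3 P h1 h2 h4 <= 672 * (P ^ 2 * D ^ 2))%N.
Proof.
move=> hn0 P_gt0 k_gt0; set M := (100 * P ^ 4)%N.
have M_gt0 : (0 < M)%N by rewrite muln_gt0 expn_gt0 P_gt0.
set D := (\max_(n < M.+1 | (0 < n)%N) size (divisors n))%N.
have hD n : (0 < n <= M)%N -> (size (divisors n) <= D)%N.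
  case/andP=> n0 nM; pose i := Ordinal (nM : (n < M.+1)%N).
  exact: (@leq_bigmax_cond _ (fun i : 'I_M.+1 => (0 < i)%N)
    (fun i : 'I_M.+1 => size (divisors i)) i).
exists D; split.
  rewrite /D; elim/big_ind: _ => [|x y hx hy|i i0].
  - by rewrite exp0n.
  - by rewrite /maxn; case: ifP.
  - apply: leq_trans (size_divisors_expn k_gt0 i0) _.
    by rewrite leq_mul2l -ltnS ltn_ord orbT.
have D_gt0 : (0 < D)%N by apply: (hD 1%N).
apply: leq_trans (card_solution_family (solution_family_T3 P h1 h2 h4) hn0 P_gt0 hD) _.
(* As [D >= 1], [D + 1 <= 2 * D], which turns 168 into 4 * 168 = 672. *)
have -> : (672 * (P ^ 2 * D ^ 2) = 168 * (P ^ 2 * (2 * D) ^ 2))%N.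
  by rewrite expnMn; lia.
rewrite !leq_mul2l /= leq_exp2r //; apply/orP; right; lia.
Qed.

Theorem corollary1p4 (R : realType) (eps : R) (eps_gt0 : 0 < eps) :
  exists C : R, forall h1 h2 h4 : int, (h1, h2, h4) <> (0, 0, 0) ->
    forall P : nat, (0 < P)%N ->
      (T3 P h1 h2 h4)%:R <= C * P%:R `^ (2 + eps).
Proof.
(* From [D ^ k <= c * P ^ 4] one gets [D ^ 2 <= (c * P ^ 4) ^ (2 / k)], where [P] has exponent
   [8 / k]; so [k >= 8 / eps] is required. *)
pose k := (Num.bound (8 / eps)).+1.
have k_gt0 : (0 : R) < k%:R by rewrite ltr0n.
have keps : 8 / k%:R <= eps.
  rewrite ler_pdivrMr // -ler_pdivrMl // mulrC.
  apply/ltW/(lt_le_trans (archi_boundP _)); first by rewrite divr_ge0 // ltW.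
  by rewrite ler_nat.
pose c : nat := ((k ^ k) ^ (2 ^ k) * 100)%N.
exists (672 * (c%:R `^ (2 / k%:R))) => h1 h2 h4 hn0 P P_gt0.
have [D [hD hT]] := @T3_bound P k h1 h2 h4 hn0 P_gt0 isT.
have P1 : (1 : R) <= P%:R by rewrite ler1n.
have P0 : (0 : R) < P%:R by rewrite ltr0n.
have hD2 : (D%:R : R) ^+ 2 <= c%:R `^ (2 / k%:R) * P%:R `^ eps.
  have -> : (D%:R : R) ^+ 2 = (D ^ k)%:R `^ (2 / k%:R).
    rewrite natrX -!powR_mulrn // -powRrM; congr (_ `^ _).
    by rewrite mulrC divfK // gt_eqF.
  apply: (@le_trans _ _ ((c%:R * P%:R ^+ 4) `^ (2 / k%:R))).
    apply: ge0_ler_powR; rewrite ?nnegrE ?divr_ge0 ?mulr_ge0 ?exprn_ge0 //.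
    by rewrite -natrX -natrM ler_nat /c -mulnA.
  rewrite powRM ?exprn_ge0 // ler_wpM2l ?powR_ge0 //.
  rewrite -powR_mulrn // -powRrM; apply: ler_powR => //.
  by apply: le_trans keps; rewrite mulrA -natrM.
apply: (@le_trans _ _ (672 * (P%:R ^+ 2 * D%:R ^+ 2))).
  by rewrite -!natrX -!natrM ler_nat.
have -> : P%:R `^ (2 + eps) = P%:R ^+ 2 * P%:R `^ eps :> R.
  by rewrite powRD ?powR_mulrn // (gt_eqF P0) implybT.
by rewrite -mulrA ler_pM2l // [leRHS]mulrCA ler_pM2l ?exprn_gt0.
Qed.
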